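(* Let $E$ be a separable Banach space and let $\Omega$ be a weak$^*$ compact and convex subset of $E^*$. Then for every $f \in \Omega$ there is a sequence $(f_n)_{n\ge1}$ in $\operatorname{ex} \Omega$ such that $\frac{f_1 + \dots + f_N}{N} \to f$ in the weak$^*$ topology of $E^*$ as $N \to \infty$.
   Context: Banach spaces are real. $\operatorname{ex}\Omega$ is the set of extreme points of $\Omega$. *)

(* Defs.v *)
From HB Require Import structures.
From mathcomp Require Import all_boot all_order all_algebra.
From mathcomp Require Import all_classical all_reals all_analysis.

Set Implicit Arguments.
Unset Strict Implicit.
Unset Printing Implicit Defensive.

Import Order.TTheory GRing.Theory Num.Theory.
Import numFieldNormedType.Exports.

Local Open Scope classical_set_scope.
Local Open Scope ring_scope.

Definition separable (T : topologicalType) : Prop :=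
  exists2 D : set T, countable D & dense D.

Definition extreme_points (R : numDomainType) (M : lmodType R) (A : set M) :
    set M :=
  [set x | A x /\ forall (y z : M) (t : R), A y -> A z -> 0 < t < 1 ->
                    x = t *: y + (1 - t) *: z -> y = x /\ z = x].

Definition in_dual (R : realType) (E : normedModType R) : {pred E -> R^o} :=
  fun f => `[< linear f /\ continuous f >].

Record dual (R : realType) (E : normedModType R) : Type := Dual
  { dual_val :> E -> R^o ; _ : dual_val \in @in_dual R E }.

Section DualTheory.
Variables (R : realType) (E : normedModType R).

HB.instance Definition _ := [isSub for @dual_val R E].
HB.instance Definition _ := [Choice of dual E by <:].

Fact in_dual_submod_closed : submod_closed (@in_dual R E).
Proof.
split=> [|a f g /asboolP[lf cf] /asboolP[lg cg]]; apply/asboolP; split.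
- by move=> k u v; rewrite /= scaler0 addr0.
- exact: cst_continuous.
- move=> k u v.
  by rewrite !fctE lf lg !scalerDr addrACA !scalerA (mulrC a).
- by move=> x; apply: cvgD; [apply: cvgZl_tmp; exact: cf|exact: cg].
Qed.

HB.instance Definition _ := GRing.isSubmodClosed.Build R (E -> R^o)
  (@in_dual R E) in_dual_submod_closed.
HB.instance Definition _ := [SubChoice_isSubLmodule of dual E by <:].

(* The topology put on the dual is the weak* one, not the norm one: it is
   induced by pointwise convergence on E. *)
HB.instance Definition _ := Topological.copy (dual E)
  (initial_topology (fun f : dual E => dual_val f : {ptws E -> R^o})).

End DualTheory.

(* Main.v *)
Require Import Defs.
From HB Require Import structures.
From mathcomp Require Import all_boot all_order all_algebra.
From mathcomp Require Import all_classical all_reals all_analysis.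
From mathcomp Require Import ring lra.

Set Implicit Arguments.
Unset Strict Implicit.
Unset Printing Implicit Defensive.

Import Order.TTheory GRing.Theory Num.Theory.
Import numFieldNormedType.Exports.

Local Open Scope classical_set_scope.
Local Open Scope ring_scope.

(** The averages are produced greedily, in the manner of a gradient descent
    whose steps are extreme points.

    Let h_n = (f_1 - f) + ... + (f_n - f) and let (z_k) be a sequence spanning
    a dense subspace of E.  If h_n were a vector of a Hilbert space and every
    new increment d_n = f_(n+1) - f satisfied <h_n, d_n> <= 0, then
    |h_(n+1)|^2 <= |h_n|^2 + |d_n|^2 would force |h_n|^2 = O(n), so that
    h_n / n -> 0.  The semi-inner products used here are
    <h, d> = \sum_(k <= n) h(z_k) d(z_k).  Their main virtue is that
    <h_n, d> = d(y_n) for the vector y_n = \sum_(k <= n) h_n(z_k) z_k of E, so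
    the condition <h_n, d_n> <= 0 reads f_(n+1)(y_n) <= f(y_n).  It holds as
    soon as f_(n+1) minimises evaluation at y_n over Omega, and by
    extreme_minimizer some extreme point does.  The z_k are scaled so that
    |d(z_k)| <= 2^-k for all increments; the increments then have bounded
    energy, and so does the coordinate that enters the sum at each step
    (greedy_energy).  Hence h_n(z_k) / n -> 0 for every k.

    An extreme minimiser is found lexicographically: E being separable, one
    minimises evaluation at y over Omega, then, successively on the set of
    minimisers, evaluation at each point of a dense sequence.  Compactness makes
    all these minimisations compatible, and what remains is a single point,
    which cannot be split.

    Finally Banach-Steinhaus makes Omega bounded in norm (compact_dual_bounded),
    which carries the convergence from the z_k to all of E (dual_cvg_dense),
    and pointwise convergence is weak* convergence (dual_cvg). *)

(** * Evaluation on the weak* dual *)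

Section dual_evaluation.
Variables (R : realType) (E : normedModType R).
Implicit Types (f g : dual E) (x : E).

Lemma dual_linear f : linear (dual_val f).
Proof. by case: f => f /= /asboolP[]. Qed.

HB.instance Definition _ f :=
  GRing.isLinear.Build R E R^o _ (dual_val f) (dual_linear f).

Lemma dual_continuous f : continuous (dual_val f).
Proof. by case: f => f /= /asboolP[]. Qed.

Lemma dualD f g x : (f + g) x = f x + g x. Proof. by []. Qed.
Lemma dualB f g x : (f - g) x = f x - g x. Proof. by []. Qed.
Lemma dualZ (a : R) f x : (a *: f) x = a * f x. Proof. by []. Qed.

Lemma dual_eval_continuous x : continuous (fun f => f x : R).
Proof.
move=> f; apply: (@continuous_comp (dual E) {ptws E -> R^o} R^o
  (fun f : dual E => dual_val f : {ptws E -> R^o}) (fun h => h x)).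
  exact: initial_continuous.
exact: (@proj_continuous _ (fun=> R^o)).
Qed.

Lemma dual_cvg (T : Type) (F : set_system T) (FF : Filter F)
    (u : T -> dual E) f :
  (forall x, (u t x : R) @[t --> F] --> (f x : R)) -> u @ F --> f.
Proof.
move=> ufx A [/= _ [[W oW <-]]] /= Wf /filterS; apply.
have: (fun t => dual_val (u t) : {ptws E -> R^o}) @ F -->
      (dual_val f : {ptws E -> R^o}).
  apply/cvg_sup => x; apply/cvg_image => //.
    by apply/seteqP; split=> // r _; exists (fun=> r).
  move=> V /= /ufx fV; exists ((fun h => h x) @^-1` V) => //.
  by apply/image_preimage/seteqP; split=> // r _; exists (fun=> r).
by apply; exact: open_nbhs_nbhs.
Qed.

Lemma dual_eq_on_dense (D : set E) f g :
  dense D -> (forall x, D x -> f x = g x) -> f = g.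
Proof.
move=> dD fg; apply/val_inj/funext => x /=.
have cl : closed [set x | f x - g x == 0 :> R].
  have -> : [set x | f x - g x == 0 :> R] =
            (fun x => (f - g) x : R) @^-1` [set 0].
    by apply/seteqP; split => z /= /eqP.
  apply: closed_comp => [z _|]; first exact: dual_continuous.
  exact: closed_eq.
apply/eqP; rewrite -subr_eq0; apply: cl => U Ux.
have [z [Dz Uz]] : (U° `&` D) !=set0.
  by apply: dD; [exists x|exact: open_interior].
by exists z; split => /=; [rewrite fg// subrr|exact: interior_subset].
Qed.

Lemma dual_cvg_dense (u : nat -> dual E) (D : set E) (B : R) :
  dense D -> 0 <= B -> (forall n x, `|u n x| <= B * `|x|) ->
  (forall x, D x -> (u n x : R) @[n --> \oo] --> (0 : R)) ->
  forall x, (u n x : R) @[n --> \oo] --> (0 : R).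
Proof.
move=> dD B0 uB uD x; apply/cvgr0Pnorm_lt => e e0.
(* B + 1 rather than B: the bound B may vanish. *)
have d0 : 0 < e / 2 / (B + 1) by rewrite !divr_gt0// ltr_wpDl.
have [z [bz Dz]] : ball x (e / 2 / (B + 1)) `&` D !=set0.
  by apply: dD; [exists x; exact: ballxx|exact: ball_open].
have /cvgr0Pnorm_lt/(_ (e / 2)) := uD z Dz.
rewrite divr_gt0// => /(_ isT); apply: filterS => n uz.
rewrite -(subrK z x) linearD (le_lt_trans (ler_normD _ _))//.
rewrite [ltRHS](splitr e) ler_ltD// (le_trans (uB _ _))//.
move: bz; rewrite -ball_normE /= => /ltW; rewrite ler_pdivlMr ?ltr_wpDl//.
by apply: le_trans; rewrite mulrC ler_wpM2l// lerDl.
Qed.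

End dual_evaluation.

(** Each evaluation is bounded on the compact set, so the uniform boundedness
    principle applies; this is where completeness of E enters. *)
Lemma compact_dual_bounded (R : realType) (E : completeNormedModType R)
    (Omega : set (dual E)) :
  compact Omega ->
  exists2 B : R, 0 <= B & forall g x, Omega g -> `|g x| <= B * `|x|.
Proof.
move=> cO.
have /(_ 1)[M ubM] :
    uniform_bounded [set (dual_val g : E -> R^o) | g in Omega].
  apply: Banach_Steinhauss.
    move=> _ [g _ <-]; split; last exact: dual_linear.
    by apply/bounded_funP/linear_bounded_continuous; exact: dual_continuous.
  move=> x.
  have: compact ((fun g : dual E => g x : R^o) @` Omega).
    apply: continuous_compact => //.
    by apply: continuous_subspaceT; exact: dual_eval_continuous.
  move=> /compact_bounded[M [_ bM]].
  by exists (M + 1) => _ [g Og <-]; apply: (bM (M + 1)); [rewrite ltrDl|exists g].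
(* M itself may be negative when Omega is empty. *)
exists (Num.max 0 M) => [|g x Og]; first by rewrite le_max lexx.
have [->|x0] := eqVneq x 0; first by rewrite linear0 !normr0 mulr0.
rewrite -ler_pdivrMr ?normr_gt0// le_max; apply/orP; right.
have := ubM (dual_val g) (ex_intro2 _ _ g Og erefl) (`|x|^-1 *: x).
rewrite normrZ normfV normr_id mulVf ?normr_eq0// lexx => /(_ isT).
by rewrite linearZ/= normrZ normfV normr_id mulrC.
Qed.

(** * Lexicographic minimisation and extreme points *)

Fixpoint lex_face (T : Type) (R : realType) (A : set T) (phi : nat -> T -> R)
    k : set T :=
  if k is k'.+1 then
    [set x | lex_face A phi k' x /\
             forall y, lex_face A phi k' y -> phi k' x <= phi k' y]
  else A.

Lemma lex_face_le (T : Type) (R : realType) (A : set T) (phi : nat -> T -> R)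
    j k : (j <= k)%N -> lex_face A phi k `<=` lex_face A phi j.
Proof.
elim: k => [|k IH]; first by rewrite leqn0 => /eqP ->.
by rewrite leq_eqVlt => /predU1P[->//|/IH jk] x [/jk].
Qed.

(** A face is the trace on A of a sublevel set of a continuous function.  Being
    closed relatively to A, rather than closed, is what can be said in a space
    that need not be Hausdorff, and it suffices for compactness. *)
Lemma lex_face_closed (T : topologicalType) (R : realType) (A : set T)
    (phi : nat -> T -> R) k :
  compact A -> A !=set0 -> (forall k, continuous (phi k)) ->
  lex_face A phi k !=set0 /\ exists2 C, closed C & lex_face A phi k = A `&` C.
Proof.
move=> cA A0 cphi; elim: k => [|k [F0 [C clC FE]]].
  by split=> //; exists setT; [exact: closedT|rewrite setIT].
have [c /set_mem Fc cmin] : exists2 c, c \in lex_face A phi k &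
    forall t, t \in lex_face A phi k -> phi k c <= phi k t.
  apply: compact_EVT_min => //; first by rewrite FE; exact: compact_closedI.
  exact: continuous_subspaceT.
split; first by exists c; split=> // y /mem_set/cmin.
exists (C `&` phi k @^-1` [set r | r <= phi k c]).
  apply: closedI => //; apply: closed_comp => [t _|]; first exact: cphi.
  exact: closed_le.
rewrite setIA -FE; apply/seteqP; split=> x /= [Fx Fmin]; split=> //.
  exact: Fmin.
by move=> y /mem_set/cmin; exact: le_trans.
Qed.

(** Choosing a point in each of the nested faces, any cluster point of this
    sequence belongs to all of them. *)
Lemma lex_face_bigcap (T : topologicalType) (R : realType) (A : set T)
    (phi : nat -> T -> R) :
  compact A -> A !=set0 -> (forall k, continuous (phi k)) ->
  exists x, forall k, lex_face A phi k x.
Proof.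
move=> cA A0 cphi.
have lexF k := lex_face_closed k cA A0 cphi.
have /choice[x_ Fx] k : exists x, lex_face A phi k x by have [] := lexF k.
have xF k : \forall n \near \oo, lex_face A phi k (x_ n).
  near=> n; apply: (@lex_face_le _ _ _ _ k n) => //.
  by near: n; exact: nbhs_infty_ge.
have [x [Ax clx]] : A `&` cluster (x_ @ \oo) !=set0.
  by apply: cA; exact: (xF 0%N).
exists x => k; have [_ [C clC FE]] := lexF k; rewrite FE; split=> //.
apply: clC => U; apply: clx; apply: filterS (xF k) => n.
by rewrite FE => -[].
Unshelve. all: by end_near. Qed.

Lemma separable_dense_seq (T : ptopologicalType) :
  separable T -> exists x : nat -> T, dense (range x).
Proof.
move=> [D /pfcard_geP[D0|[x]]] dD.
  by move: dD; rewrite D0 => /dense0.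
by exists x => O O0 oO; rewrite (image_eq x); exact: dD.
Qed.

(** Minimising first at y and then at each point of a dense sequence leaves a
    point e of all the faces.  If e is a proper convex combination of g and h,
    then g and h also minimise each evaluation, so they lie in all the faces
    and agree with e on a dense set. *)
Lemma extreme_minimizer (R : realType) (E : normedModType R)
    (Omega : set (dual E)) (y : E) :
  separable E -> compact Omega -> Omega !=set0 ->
  exists2 e, extreme_points Omega e & forall g, Omega g -> e y <= g y.
Proof.
move=> /separable_dense_seq[x dx] cO O0.
pose phi k (g : dual E) : R := g (if k is k'.+1 then x k' else y).
have [e eF] := lex_face_bigcap cO O0
  (fun k => @dual_eval_continuous R E _ : continuous (phi k)).
exists e; last by move=> g; exact: (eF 1%N).2.
split=> [|g h t Og Oh /andP[t0 t1] egh]; first exact: (eF 0%N).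
have eE k : phi k e = t * phi k g + (1 - t) * phi k h by rewrite /phi {1}egh.
have s0 : 0 < 1 - t by rewrite subr_gt0.
have face k : lex_face Omega phi k g /\ lex_face Omega phi k h ->
    phi k g = phi k e /\ phi k h = phi k e.
  move=> [Fg Fh]; have [_ emin] := eF k.+1.
  by move: (emin _ Fg) (emin _ Fh) (eE k); split; nra.
have FF k : lex_face Omega phi k g /\ lex_face Omega phi k h.
  elim: k => [//|k IH]; have [gE hE] := face k IH; have [_ emin] := eF k.+1.
  by split; split; [exact: IH.1|rewrite gE|exact: IH.2|rewrite hE].
by split; apply: (dual_eq_on_dense dx) => _ [k _ <-]; have [] := face k.+1 (FF _).
Qed.

(** * Energy estimate for greedy sums *)

Lemma sum_half_pow (R : realFieldType) n :
  \sum_(k < n) (2^-1 ^+ k) ^+ 2 <= 2 - 2 * 2^-1 ^+ n :> R.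
Proof.
elim: n => [|n IH]; first by rewrite big_ord0 expr0; lra.
rewrite big_ord_recr /= [2^-1 ^+ n.+1]exprS.
have t0 : 0 <= 2^-1 ^+ n :> R by rewrite exprn_ge0.
have t1 : 2^-1 ^+ n <= 1 :> R by rewrite exprn_ile1//; lra.
have tt : (2^-1 ^+ n) ^+ 2 <= 2^-1 ^+ n :> R by rewrite expr2 ler_piMl.
by move: IH tt {t0 t1}; move: (2^-1 ^+ n) => t IH tt; lra.
Qed.

Lemma nat_half_pow (R : realFieldType) n : n%:R * 2^-1 ^+ n <= 1 :> R.
Proof.
rewrite exprVn ler_pdivrMr ?exprn_gt0// mul1r -natrX ler_nat.
exact/ltnW/ltn_expl.
Qed.

(** Here a n k stands for the k-th coordinate of the n-th partial sum.  The
    truncation at n.+1 in step_obtuse keeps all the sums finite. *)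
Section greedy.
Variables (R : realType) (a : nat -> nat -> R).
Hypothesis a0 : forall k, a 0 k = 0.
Hypothesis step_le : forall n k, `|a n.+1 k - a n k| <= 2^-1 ^+ k.
Hypothesis step_obtuse :
  forall n, \sum_(k < n.+1) a n k * (a n.+1 k - a n k) <= 0.

(** Each step adds at most 3 to the energy: at most 2 from the square of the
    increment, nothing from the cross term, and at most 1 from the coordinate n
    that enters the sum, as `|a n n| <= n 2^-n <= 1. *)
Lemma greedy_energy n : \sum_(k < n) a n k ^+ 2 <= 3 * n%:R.
Proof.
have a_le m k : `|a m k| <= m%:R * 2^-1 ^+ k.
  elim: m => [|m IH]; first by rewrite a0 normr0 mul0r.
  rewrite -(subrK (a m k) (a m.+1 k)) (le_trans (ler_normD _ _))//.
  by rewrite -natr1 mulrDl mul1r addrC lerD.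
elim: n => [|n IH]; first by rewrite big_ord0 mulr0.
have -> : \sum_(k < n.+1) a n.+1 k ^+ 2 =
    \sum_(k < n.+1) a n k ^+ 2
    + 2 * (\sum_(k < n.+1) a n k * (a n.+1 k - a n k))
    + \sum_(k < n.+1) (a n.+1 k - a n k) ^+ 2.
  by rewrite mulr_sumr -!big_split /=; apply: eq_bigr => k _; ring.
have step2 : \sum_(k < n.+1) (a n.+1 k - a n k) ^+ 2 <= 2.
  apply: (@le_trans _ _ (\sum_(k < n.+1) (2^-1 ^+ k) ^+ 2)).
    apply: ler_sum => k _; rewrite -real_normK ?num_real//.
    by rewrite ler_sqr ?nnegrE// exprn_ge0.
  apply: (le_trans (sum_half_pow _ _)).
  by rewrite lerBlDr lerDl mulr_ge0// exprn_ge0.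
have new1 : a n n ^+ 2 <= 1.
  rewrite -real_normK ?num_real// expr_le1// (le_trans (a_le _ _))//.
  exact: nat_half_pow.
rewrite big_ord_recr /= -natr1.
by have := step_obtuse n; lra.
Qed.

Lemma greedy_cvg k : (n%:R^-1 * a n k) @[n --> \oo] --> (0 : R).
Proof.
apply/cvgr0Pnorm_lt => e e0.
near=> n.
have n0 : 0 < n%:R :> R by rewrite ltr0n; near: n; exact: nbhs_infty_gt.
have kn : (k < n)%N by near: n; exact: nbhs_infty_gt.
have en : 3 < e ^+ 2 * n%:R.
  by rewrite -ltr_pdivrMl ?exprn_gt0//; near: n; exact: nbhs_infty_gtr.
rewrite -ltr_sqr ?nnegrE ?(ltW e0)// real_normK ?num_real// exprMn exprVn.
rewrite ltr_pdivrMl ?exprn_gt0//.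
have : a n k ^+ 2 <= 3 * n%:R.
  apply: le_trans (greedy_energy n); rewrite (bigD1 (Ordinal kn))//= lerDl.
  by apply: sumr_ge0 => i _; exact: sqr_ge0.
by move/le_lt_trans; apply; nra.
Unshelve. all: by end_near. Qed.

End greedy.

(** * Greedy sums of functionals *)

Section greedy_choice.
Variables (R : realType) (E : normedModType R) (f : dual E).
Variables (e : E -> dual E) (z : nat -> E).

(** The argument of e is the vector of E that represents the semi-inner product
    with the current excess, taken on the coordinates z_0, ..., z_m. *)
Fixpoint excess n : dual E :=
  if n is m.+1 then
    excess m + (e (\sum_(k < m.+1) excess m (z k) *: z k) - f)
  else 0.

Definition greedy_choice n := e (\sum_(k < n.+1) excess n (z k) *: z k).

Lemma excessS n : excess n.+1 = excess n + (greedy_choice n - f).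
Proof. by []. Qed.

Lemma sum_greedy_choice N :
  \sum_(n < N) greedy_choice n = excess N + N%:R *: f.
Proof.
elim: N => [|N IH]; first by rewrite big_ord0 scale0r addr0.
by rewrite big_ord_recr /= IH -natr1 scalerDl scale1r addrACA subrK.
Qed.

Lemma excess_cvg k : (forall y, e y y <= f y) ->
  (forall y k, `|(e y - f) (z k)| <= 2^-1 ^+ k) ->
  (n%:R^-1 *: excess n) (z k) @[n --> \oo] --> (0 : R).
Proof.
move=> emin ez.
apply: (@greedy_cvg R (fun n k => excess n (z k))) => [//|n j|n].
  by rewrite excessS dualD addrAC subrr add0r; exact: ez.
have := emin (\sum_(k < n.+1) excess n (z k) *: z k).
rewrite -subr_le0 -dualB linear_sum; congr (_ <= 0).
apply: eq_bigr => j _; rewrite linearZ /=; congr (_ * _).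
by rewrite addrAC subrr add0r.
Qed.

End greedy_choice.

(** * Averages of extreme points *)

Theorem proposition5 (R : realType) (E : completeNormedModType R)
    (hE : separable E) (Omega : set (dual E))
    (hOmega_compact : compact Omega)
    (hOmega_convex : convex_set Omega)
    (f : dual E) (hf : Omega f) :
  exists f_ : nat -> dual E,
    (forall n, (1 <= n)%N -> extreme_points Omega (f_ n)) /\
    (N%:R^-1 *: \sum_(1 <= n < N.+1) f_ n) @[N --> \oo] --> f.
Proof.
have [x dx] := separable_dense_seq hE.
have [B B0 OB] := compact_dual_bounded hOmega_compact.
have O0 : Omega !=set0 by exists f.
have /choice[e eP] y :
    exists e, extreme_points Omega e /\ forall g, Omega g -> e y <= g y.
  by have [e] := extreme_minimizer y hE hOmega_compact O0; exists e.
have eB y w : `|(e y - f) w| <= 2 * B * `|w|.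
  rewrite mulr_natl mulr2n mulrDl (le_trans (ler_normB _ _))//.
  by apply: lerD; apply: OB => //; exact: (eP y).1.1.
(* This scaling gives the bound 2^-k on the k-th coordinate of the increments;
   adding 1 covers the case where B or x k vanishes. *)
pose c k : R := 2^-1 ^+ k / (2 * B * `|x k| + 1).
have den k : 0 < 2 * B * `|x k| + 1 by rewrite ltr_wpDl// !mulr_ge0.
have c0 k : 0 < c k by rewrite divr_gt0// exprn_gt0.
pose z k := c k *: x k.
have ez y k : `|(e y - f) (z k)| <= 2^-1 ^+ k.
  rewrite (le_trans (eB _ _))// normrZ gtr0_norm// mulrCA /c mulrAC.
  by rewrite ler_pdivrMr// ler_wpM2l ?exprn_ge0// lerDl.
have hz k := excess_cvg k (fun y => (eP y).2 f hf) ez.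
exists (fun n => greedy_choice f e z n.-1); split=> [n _|]; first exact: (eP _).1.
pose u N : dual E := N%:R^-1 *: excess f e z N.
have uB N w : `|u N w| <= 2 * B * `|w|.
  rewrite /u dualZ normrM normfV normr_nat.
  have [->|N0] := posnP N; first by rewrite invr0 mul0r !mulr_ge0.
  rewrite ler_pdivrMl ?ltr0n//.
  elim: (N) => [|n IH]; first by rewrite /= normr0 mul0r.
  rewrite excessS dualD (le_trans (ler_normD _ _))// -natr1 mulrDl mul1r.
  by apply: lerD => //; exact: eB.
have u0 w : (u N w : R) @[N --> \oo] --> (0 : R).
  apply: (dual_cvg_dense dx _ uB); first by rewrite mulr_ge0.
  move=> _ [k _ <-].
  have -> : (fun N => u N (x k)) = (fun N => (c k)^-1 * u N (z k)).
    by apply/funext => N; rewrite /z linearZ /= mulKf// gt_eqF.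
  by rewrite -(mulr0 (c k)^-1); apply: cvgMr; exact: hz.
apply: dual_cvg => w.
rewrite -[X in _ --> X]add0r.
have : (u N w + f w : R) @[N --> \oo] --> (0 + f w : R).
  by apply: cvgD => //; exact: cvg_cst.
apply: cvg_trans; apply: near_eq_cvg; near=> N.
have N0 : (0 < N)%N by near: N; exact: nbhs_infty_gt.
rewrite big_add1 big_mkord /= sum_greedy_choice scalerDr scalerA.
by rewrite mulVf ?scale1r// pnatr_eq0 -lt0n.
Unshelve. all: by end_near. Qed.
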